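(* Let $R$ be a commutative ring with unit, let $V=R\mathbb{N}$ be the free $R$-module with basis $(e_n)_{n\in\mathbb{N}}$, and let $U\colon V\to V$ be the $R$-linear map with $U(e_n)=e_{n+1}$ for all $n\in\mathbb{N}$. Then $(V,e_0,U)$ is the initial $R$-linear induction algebra: for every $R$-linear induction algebra $(W,w,S)$ there is a unique $R$-linear map $\phi\colon V\to W$ such that $\phi(e_0)=w$ and $\phi\circ U=S\circ\phi$.
   Context: An $R$-linear induction algebra is a triple $(W,w,S)$ where $W$ is an $R$-module, $w\in W$, and $S\colon W\to W$ is an $R$-linear map. *)

(* Defs.v *)
From HB Require Import structures.
From mathcomp Require Import all_boot all_algebra finmap monalg.

Set Implicit Arguments.
Unset Strict Implicit.
Unset Printing Implicit Defensive.

Import GRing.Theory.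
Local Open Scope fset_scope.
Local Open Scope ring_scope.

(* Finitely supported functions nat -> R.  The library's module structure on  *)
(* {malg R[nat]} requires 1 != 0 in R; it is redefined on this alias so that  *)
(* R may be the zero ring.                                                    *)
Definition freeN (R : comPzRingType) : Type := {malg R[nat]}.

HB.instance Definition _ (R : comPzRingType) := GRing.Zmodule.on (freeN R).

Section FreeN.
Variable R : comPzRingType.
Implicit Types (a b : R) (u v : freeN R) (k n : nat).

Definition freeN_scale a u : freeN R :=
  [malg k in msupp u => a * mcoeff k u].

Lemma mcoeff_freeN_scale a u k : mcoeff k (freeN_scale a u) = a * mcoeff k u.
Proof. by rewrite mcoeffE; case: msuppP; rewrite ?mulr0. Qed.

Lemma freeN_scaleA a b u :
  freeN_scale a (freeN_scale b u) = freeN_scale (a * b) u.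
Proof. by apply/malgP => k; rewrite !mcoeff_freeN_scale mulrA. Qed.

Lemma freeN_scale1 : left_id 1 freeN_scale.
Proof. by move=> u; apply/malgP => k; rewrite mcoeff_freeN_scale mul1r. Qed.

Lemma freeN_scaleDr : right_distributive freeN_scale +%R.
Proof.
by move=> a u v; apply/malgP => k; rewrite !(mcoeffD, mcoeff_freeN_scale) mulrDr.
Qed.

Lemma freeN_scaleDl u : {morph freeN_scale^~ u : a b / a + b}.
Proof.
by move=> a b; apply/malgP => k; rewrite !(mcoeffD, mcoeff_freeN_scale) mulrDl.
Qed.

HB.instance Definition _ := GRing.Zmodule_isLmodule.Build R (freeN R)
  freeN_scaleA freeN_scale1 freeN_scaleDr freeN_scaleDl.

Lemma mcoeff_freeNZ a u k : mcoeff k (a *: u) = a * mcoeff k u.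
Proof. exact: mcoeff_freeN_scale. Qed.

Definition basisN n : freeN R := << (1 : R) *g n >>.

(* Together with freeN_shift_basis below, this shows that a linear map sending  *)
(* e_n to e_(n+1) exists.                                                     *)
Definition freeN_shift u : freeN R :=
  [malg k in [fset n.+1 | n in msupp u] => mcoeff k.-1 u].

Lemma mcoeff_freeN_shift u k :
  mcoeff k (freeN_shift u) = if k is n.+1 then mcoeff n u else 0.
Proof.
rewrite mcoeffE; case: k => [|n]; first by case: imfsetP => // -[].
case: imfsetP => [//|nu]; apply/esym/mcoeff_outdom.
by apply/negP => un; apply: nu; exists n.
Qed.

Lemma freeN_shift_is_linear : linear freeN_shift.
Proof.
move=> a u v; apply/malgP => k.
rewrite mcoeffD mcoeff_freeNZ !mcoeff_freeN_shift.
by case: k => [|k]; rewrite ?mulr0 ?addr0 // mcoeffD mcoeff_freeNZ.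
Qed.

HB.instance Definition _ :=
  GRing.isLinear.Build R (freeN R) (freeN R) *:%R freeN_shift
    freeN_shift_is_linear.

Lemma freeN_shift_basis n : freeN_shift (basisN n) = basisN n.+1.
Proof.
by apply/malgP => -[|k]; rewrite mcoeff_freeN_shift !mcoeffU.
Qed.

End FreeN.

Record indAlg (R : comPzRingType) := IndAlg {
  carrier :> lmodType R;
  base : carrier;
  step : {linear carrier -> carrier}
}.

Definition is_indAlg_hom (R : comPzRingType) (A B : indAlg R)
    (phi : {linear A -> B}) : Prop :=
  phi (base A) = base B /\ phi \o step A =1 step B \o phi.

Definition initial_indAlg (R : comPzRingType) (A : indAlg R) : Prop :=
  forall B : indAlg R, exists phi : {linear A -> B},
    is_indAlg_hom phi /\
    forall psi : {linear A -> B}, is_indAlg_hom psi -> psi =1 phi.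

(* Main.v *)
Require Import Defs.
From HB Require Import structures.
From mathcomp Require Import all_boot all_algebra finmap monalg.

Set Implicit Arguments.
Unset Strict Implicit.
Unset Printing Implicit Defensive.

Import GRing.Theory.
Local Open Scope fset_scope.
Local Open Scope ring_scope.

(** A linear map out of the free module amounts to an arbitrary choice of values on the basis:
    [freeN_lift] extends any sequence, and [freeN_linear_ext] gives uniqueness. A morphism to
    [(W, w, S)] is forced to send [e_n] to [S^n w], by induction on [n]. Conversely, the extension
    of this sequence is a morphism, because [phi \o U] and [S \o phi] are linear and agree on the
    basis. *)

Section Lift.
Variables (R : comPzRingType) (W : lmodType R) (f : nat -> W).
Implicit Types u v : freeN R.

Definition freeN_lift u : W := \sum_(k <- msupp u) mcoeff k u *: f k.

(** Coefficients vanish off the support, so extra indices contribute zero. This lets sums over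
    different supports be compared over one index set. *)
Lemma freeN_lift_fsubset (d : {fset nat}) u :
  msupp u `<=` d -> freeN_lift u = \sum_(k <- d) mcoeff k u *: f k.
Proof.
move=> sud; rewrite /freeN_lift; apply: big_fset_incl => // k _ /mcoeff_outdom ->.
by rewrite scale0r.
Qed.

Lemma freeN_lift_is_linear : linear freeN_lift.
Proof.
move=> a u v; set d := msupp u `|` msupp v `|` msupp (a *: u + v).
rewrite !(@freeN_lift_fsubset d).
- rewrite scaler_sumr -big_split /=; apply: eq_bigr => k _.
  by rewrite mcoeffD mcoeff_freeNZ scalerDl scalerA.
- by rewrite /d -fsetUA fsetUCA fsubsetUl.
- by rewrite /d -fsetUA fsubsetUl.
- by rewrite fsubsetUr.
Qed.

HB.instance Definition _ :=
  GRing.isLinear.Build R (freeN R) W *:%R freeN_lift freeN_lift_is_linear.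

Lemma freeN_lift_basis n : freeN_lift (basisN R n) = f n.
Proof.
rewrite (@freeN_lift_fsubset [fset n]) ?msuppU_le //.
by rewrite big_seq_fset1 mcoeffUU scale1r.
Qed.

End Lift.

(** The basis spans: [monalgE] expands [u] into monomials, and each has the same coefficients as a
    scalar multiple of a basis vector. *)
Lemma freeN_basisE (R : comPzRingType) (u : freeN R) :
  u = freeN_lift (basisN R) u.
Proof.
apply/malgP => n; rewrite /freeN_lift raddf_sum /= [in LHS](monalgE u) raddf_sum.
by apply: eq_bigr => k _ /=; rewrite mcoeff_freeNZ !mcoeffU mulr_natr.
Qed.

Lemma freeN_linear_ext (R : comPzRingType) (W : lmodType R)
    (g h : {linear freeN R -> W}) :
  (forall n, g (basisN R n) = h (basisN R n)) -> g =1 h.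
Proof.
move=> gh u; rewrite (freeN_basisE u) /freeN_lift !linear_sum.
by apply: eq_bigr => k _; rewrite !linearZ_LR /= gh.
Qed.

Theorem mainTheorem2 (R : comPzRingType) (U : {linear freeN R -> freeN R})
    (U_basis : forall n : nat, U (basisN R n) = basisN R n.+1) :
  initial_indAlg (IndAlg (basisN R 0) U).
Proof.
move=> B; pose f n := iter n (step B) (base B).
exists (freeN_lift f : {linear freeN R -> B}).
split=> [|psi [psi0 psiS]].
  split; first exact: freeN_lift_basis.
  apply: (@freeN_linear_ext _ _ (freeN_lift f \o U) (step B \o freeN_lift f)).
  (* At [e_n] both sides are [f n.+1], since [iter] applies the new step outermost. *)
  by move=> n /=; rewrite U_basis !freeN_lift_basis.
apply: (@freeN_linear_ext _ _ psi (freeN_lift f)) => n /=.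
rewrite freeN_lift_basis; elim: n => [//|n IHn].
(* Writing [e_(n+1)] as [U e_n] lets [psiS] move the step outside [psi]. *)
by rewrite -U_basis [LHS]psiS /= IHn.
Qed.
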